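(* For any integer $k\ge2$ there exists a non-very generic generic arrangement $\mathcal{A}$ consisting of a sufficiently large number $n$ of hyperplanes in $\mathbb{R}^k$ (or $\mathbb{C}^k$) such that $\mathcal{L}(\mathcal{B}(n,k,\mathcal{A}))$ contains a dense intersection.
   Context: A central arrangement $\mathcal{A}=\{H_1,\dots,H_n\}$ in $\mathbb{R}^k$ ($k<n$), with normals $\alpha_i$, is generic if any $m\le k$ of its hyperplanes intersect in codimension $m$. Identify $\mathbb{R}^n$ with the space of parallel translates via $t\mapsto(H_i+t_i\alpha_i)_i$. For $L\subset[n]$, $|L|=k+1$, $D_L=\{t\mid\bigcap_{i\in L}(H_i+t_i\alpha_i)\ne\emptyset\}$; $\mathcal{B}(n,k,\mathcal{A})=\{D_L\}$ is the discriminantal arrangement with intersection poset $\mathcal{L}(\mathcal{B}(n,k,\mathcal{A}))$. For $|S|\ge k+1$, $D_S=\bigcap_{L\subset S,|L|=k+1}D_L$. $D_S$ is a component of $X$ if $X\subset D_S$ and $X\not\subset D_{S\cup\{j\}}$ for all $j\notin S$; the canonical presentation $\{S_1,\dots,S_m\}$ of $X$ is the set of index sets of all its components. Athanasiadis rank $a_X=\sum_i(|S_i|-k)$; $\operatorname{rank}(X)$ is the codimension; $X$ is very generic if $\operatorname{rank}(X)=a_X$, non-very generic otherwise. $\mathcal{A}$ is non-very generic if $\mathcal{L}(\mathcal{B}(n,k,\mathcal{A}))$ contains a non-very generic intersection. A non-very generic $X$ is minimal if every $Y\in\mathcal{L}$ with $Y\supsetneq X$ is very generic. A minimal non-very generic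 intersection $X$ is dense if $a_X=\operatorname{rank}(X)+k-1$. (The same definitions apply over $\mathbb{C}$.) *)

(* Defs.v *)
From HB Require Import structures.
From mathcomp Require Import all_boot all_order all_algebra.
From mathcomp Require Import boolp classical_sets reals.
From mathcomp Require Export complex.

Set Implicit Arguments.
Unset Strict Implicit.
Unset Printing Implicit Defensive.

Import GRing.Theory.
Local Open Scope classical_set_scope.
Local Open Scope ring_scope.

(* An arrangement of n central hyperplanes in F^k is given by the n x k matrix
   A of its normals: row i A is alpha_i.  Orthogonality is taken with respect
   to <x, y> = \sum_j x_j * conj y_j, with conj the identity when F is the
   field of real numbers and the complex conjugation when F is the field of
   complex numbers; in both cases alpha_i <> 0 implies that alpha_i is not in
   H_i, so that t_i |-> H_i + t_i alpha_i does parametrize the parallels of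
   H_i. *)
Section Discriminantal.
Variables (F : fieldType) (conj : F -> F) (n k : nat) (A : 'M[F]_(n, k)).

Definition hyperplane (i : 'I_n) : {vspace 'rV[F]_k} :=
  lker (linfun (mulmxr (map_mx conj (row i A))^T : 'rV[F]_k -> 'M[F]_1)).

(* The case #|I| = 1 says that the alpha_i are nonzero. *)
Definition generic_arrangement : Prop :=
  forall I : {set 'I_n}, (#|I| <= k)%N ->
    (\dim (\bigcap_(i in I) hyperplane i)%VS + #|I| = k)%N.

Definition translate (t : 'rV[F]_n) (i : 'I_n) : set 'rV[F]_k :=
  [set x + t 0 i *: row i A | x in [set` hyperplane i]].

Definition D1 (L : {set 'I_n}) : set 'rV[F]_n :=
  [set t | \bigcap_(i in [set` L]) translate t i !=set0].

(* For #|S| = k + 1 this is D1 S; it is only meaningful for #|S| >= k + 1. *)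
Definition D (S : {set 'I_n}) : set 'rV[F]_n :=
  \bigcap_(L in [set L : {set 'I_n} | (L \subset S) && (#|L| == k.+1)]) D1 L.

(* X is an intersection of hyperplanes D_L (the empty one being F^n).  Each D_L
   is a linear subspace, so nothing is lost by taking X in {vspace _}. *)
Definition in_lattice (X : {vspace 'rV[F]_n}) : Prop :=
  exists2 T : {set {set 'I_n}}, (forall L, L \in T -> #|L| = k.+1) &
    [set` X] = \bigcap_(L in [set` T]) D1 L.

Definition is_component (X : {vspace 'rV[F]_n}) (S : {set 'I_n}) : Prop :=
  [/\ (k < #|S|)%N, [set` X] `<=` D S &
      forall j, j \notin S -> ~ ([set` X] `<=` D (j |: S)%SET)].

Definition canonical_presentation (X : {vspace 'rV[F]_n}) : {set {set 'I_n}} :=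
  finset (fun S : {set 'I_n} => `[< is_component X S >]).

Definition athanasiadis_rank (X : {vspace 'rV[F]_n}) : nat :=
  (\sum_(S in canonical_presentation X) (#|S| - k))%N.

Definition codim (X : {vspace 'rV[F]_n}) : nat := (n - \dim X)%N.

Definition very_generic (X : {vspace 'rV[F]_n}) : Prop :=
  codim X = athanasiadis_rank X.

Definition non_very_generic_arrangement : Prop :=
  exists2 X, in_lattice X & ~ very_generic X.

Definition minimal_non_very_generic (X : {vspace 'rV[F]_n}) : Prop :=
  [/\ in_lattice X, ~ very_generic X &
      forall Y, in_lattice Y -> (X <= Y)%VS -> Y <> X -> very_generic Y].

Definition dense_intersection (X : {vspace 'rV[F]_n}) : Prop :=
  minimal_non_very_generic X /\
  athanasiadis_rank X = (codim X + (k - 1))%N.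

End Discriminantal.

Definition exists_dense_arrangement (F : fieldType) (conj : F -> F)
    (k n : nat) : Prop :=
  (k < n)%N /\
  exists A : 'M[F]_(n, k),
    [/\ generic_arrangement conj A, non_very_generic_arrangement conj A &
        exists X, dense_intersection conj A X].

(* Main.v *)
Require Import Defs.
From mathcomp Require Import boolp classical_sets.
From mathcomp Require Import all_boot all_order all_algebra reals complex ring zify.

(* After rescaling t_i by |alpha_i|^2, the normal of D_L is the unique relation
   v A = 0 between the normals alpha_i with support L, so an intersection X is a
   code (its normal space), the hyperplanes D_L containing X being its words of
   weight k + 1.  Suppose that a code of dimension k + 1 has no nonzero word of
   weight at most k, exactly 2k words of weight k + 1 up to scalars, and that
   any k + 1 of these are independent.  Then codim X = k + 1 and a_X = 2k, while
   every larger intersection has normal space spanned by at most k independent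
   words, which are its components: X is dense.  Such a code is always
   orthogonal to the columns of some n x k matrix A whose k x k minors are all
   nonzero, and that A is the arrangement.

   For k >= 3 the code consists of the evaluations of the polynomials p of degree
   at most k at 2k points w_j, w_j + 1 together with the two functionals
   p_(k-1) + (W + d) p_k, d = 1 and d = k - 1, where W is the sum of the w_j.
   The w_j are multiples of powers of 3, so that the only sums of k points equal
   to W + d are those which use every pair {w_j, w_j + 1} once and the second
   point d times: these are the zero sets of the 2k minimal words.  For k = 2 the
   two values of d coincide, and the code is the cut space of K_4 instead. *)

Set Implicit Arguments.
Unset Strict Implicit.
Unset Printing Implicit Defensive.

Import Order.TTheory GRing.Theory Num.Theory.
Local Open Scope ring_scope.

(** * Matrices with independent rows *)

Section Support.
Variable F : fieldType.

Definition supp n (v : 'rV[F]_n) : {set 'I_n} := [set j | v 0 j != 0].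

Lemma card_supp n (v : 'rV[F]_n) : #|supp v| = (\sum_j (v 0 j != 0)%R)%N.
Proof.
rewrite -sum1_card big_mkcond /=; apply: eq_bigr => j _.
by rewrite inE; case: eqP.
Qed.

Lemma card_supp_row_mx n1 n2 (u : 'rV[F]_n1) (v : 'rV[F]_n2) :
  #|supp (row_mx u v)| = (#|supp u| + #|supp v|)%N.
Proof.
rewrite !card_supp big_split_ord /=.
by congr addn; apply: eq_bigr => j _; rewrite ?row_mxEl ?row_mxEr.
Qed.

Lemma suppZ n (c : F) (v : 'rV[F]_n) : c != 0 -> supp (c *: v) = supp v.
Proof. by move=> c0; apply/setP=> j; rewrite !inE mxE mulf_eq0 (negPf c0). Qed.

Lemma supp0 n : supp (0 : 'rV[F]_n) = set0.
Proof. by apply/setP=> j; rewrite !inE mxE eqxx. Qed.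

Lemma kernel0_row_free m n (M : 'M[F]_(m, n)) :
  (forall x : 'rV_m, x *m M = 0 -> x = 0) -> row_free M.
Proof.
move=> h; rewrite -kermx_eq0; apply/eqP/row_matrixP => i; rewrite row0.
by apply: h; rewrite -row_mul mulmx_ker row0.
Qed.

Lemma dim_ker n m (N : 'M[F]_(n, m)) (Y : {vspace 'rV[F]_n}) :
  row_full N -> (forall t, (t \in Y) = (t *m N == 0)) -> (\dim Y + m = n)%N.
Proof.
move=> fN hY; pose f := linfun (mulmxr N : 'rV[F]_n -> 'rV[F]_m).
have <- : lker f = Y by apply/vspaceP=> t; rewrite memv_ker lfunE hY.
have fullf : limg f = fullv.
  apply/vspaceP => y; rewrite memvf; apply/memv_imgP.
  exists (y *m pinvmx N); rewrite ?memvf //.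
  by rewrite lfunE /= mulmxKpV // submx_full.
have := limg_ker_dim f fullv; rewrite capfv fullf !dimvf.
by rewrite !dim_matrix !mul1r.
Qed.

End Support.

(** * Normals in general position orthogonal to a given code *)

Section Interpolation.
Variable F : numFieldType.

Lemma nat_nonroot (p : {poly F}) : p != 0 -> exists t : nat, p.[t%:R] != 0.
Proof.
move=> p0; case: (boolP (all (root p) [seq i%:R | i <- iota 0 (size p)])).
  move=> h; have := max_poly_roots p0 h.
  rewrite map_inj_uniq ?iota_uniq ?size_map ?size_iota ?ltnn; first by move=> /(_ isT).
  by move=> i j /eqP; rewrite eqr_nat => /eqP.
by case/allPn=> _ /mapP [t _ ->] h; exists t.
Qed.

(** General position in terms of relations: any k rows are independent, so for m = k the k x k
    minors are nonzero. *)
Definition k_independent n m k (A : 'M[F]_(n, m)) :=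
  forall y : 'rV_n, (#|supp y| <= k)%N -> y *m A = 0 -> y = 0.

Definition moment_mx d j (t : nat -> nat) : 'M[F]_(d, j) :=
  \matrix_(a, b) (t b)%:R ^+ a.

(* The nodes are chosen one after the other: with s columns, any s rows are
   independent; a set of s + 1 rows then has at most one relation with respect
   to these s columns, and a further node violates it unless it is a root of
   one of finitely many nonzero polynomials. *)
Lemma k_independent_mul_moment n d k (W : 'M[F]_(n, d)) : k_independent k W ->
  exists t, k_independent k (W *m moment_mx d k t).
Proof.
move=> hW.
suff: forall j, (j <= k)%N -> exists t, k_independent j (W *m moment_mx d j t) by exact.
elim=> [|j IHj] lejk.
  exists (fun=> 0%N) => y; rewrite leqn0 cards_eq0 => /eqP y0 _.
  apply/rowP=> i; rewrite mxE; apply/eqP; apply: contraT => yi.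
  by have := in_set0 i; rewrite -y0 inE yi.
have [t ht] := IHj (ltnW lejk).
set A := W *m _ in ht.
(* One polynomial q for each possible support K: at a node that is not a root of q, no relation with
   support K survives. *)
have hK (K : {set 'I_n}) : exists q : {poly F}, q != 0 /\ forall x : nat,
    q.[x%:R] != 0 -> forall y, #|supp y| = j.+1 -> supp y = K -> y *m A = 0 ->
    (rVpoly (y *m W)).[x%:R] = 0 -> y = 0.
  case: (pselect (exists y, [/\ #|supp y| = j.+1, supp y = K & y *m A = 0]));
    last first.
    by move=> no; exists 1; split=> [|x _ y *]; [apply: oner_neq0|case: no; exists y].
  case=> y [cy sy yA]; exists (rVpoly (y *m W)); split.
    apply/eqP => /(congr1 (@poly_rV F d)); rewrite rVpolyK linear0 => /hW.
    rewrite cy => /(_ lejk) y0; move: cy.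
    by rewrite y0 supp0 cards0.
  move=> x qx y' cy' sy' y'A y'x.
  have /card_gt0P [i iK] : (0 < #|K|)%N by rewrite -sy cy.
  have yi : y 0 i != 0 by move: iK; rewrite -sy inE.
  have y'i : y' 0 i != 0 by move: iK; rewrite -sy' inE.
  (* z loses the coordinate i, so it has at most j nonzero entries and the induction hypothesis
     gives z = 0: relations with support K are proportional. *)
  pose z := y 0 i *: y' - y' 0 i *: y.
  have z0 : z = 0.
    apply: ht; last by rewrite mulmxBl -!scalemxAl yA y'A !scaler0 subr0.
    rewrite -ltnS -cy sy; apply: proper_card; apply/properP; split; last first.
      by exists i => //; rewrite inE !mxE mulrC subrr eqxx.
    apply/subsetP=> l; rewrite inE !mxE; apply: contraR => lK.
    have /eqP -> : y 0 l == 0 by move: lK; rewrite -sy inE negbK.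
    have /eqP -> : y' 0 l == 0 by move: lK; rewrite -sy' inE negbK.
    by rewrite !mulr0 subr0.
  move/eqP: qx; case.
  have -> : y = (y' 0 i)^-1 *: (y 0 i *: y').
    move/eqP: z0; rewrite subr_eq0 => /eqP ->.
    by rewrite scalerA mulVf // scale1r.
  by rewrite -!scalemxAl !linearZ !hornerZ /= y'x !mulr0.
have [q hq] := fin_all_exists hK.
have [x hx] : exists x : nat, (\prod_K q K).[x%:R] != 0.
  by apply: nat_nonroot; apply/prodf_neq0 => K _; case: (hq K).
pose t' b := if b == j then x else t b.
exists t' => y cy yA.
have yAj : y *m A = 0.
  apply/rowP => b; have /rowP/(_ (widen_ord (leqnSn j) b)) := yA.
  rewrite mulmxA mxE [RHS]mxE => E; rewrite /A mulmxA mxE [RHS]mxE -[RHS]E.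
  by apply: eq_bigr => a _; rewrite !mxE /t' /= ltn_eqF.
move: cy; rewrite leq_eqVlt => /orP[/eqP cy|]; last first.
  by rewrite ltnS => cy; apply: ht.
have [_ /(_ x)] := hq (supp y); apply=> //.
  by move: hx; rewrite (bigD1 (supp y)) //= hornerM mulf_eq0 negb_or => /andP[].
have /rowP/(_ ord_max) := yA; rewrite mulmxA mxE [RHS]mxE => <-.
rewrite (horner_coef_wide _ (size_poly _ _)); apply: eq_bigr => a _.
by rewrite coef_rVpoly_ord !mxE /t' /= eqxx.
Qed.

(** The relations between the rows of [cokermx B] are the vectors of the row space of [B], so the
    hypothesis says that [cokermx B] is k-independent. A moment matrix on its right cuts it down to
    k columns, and natural nodes keep the entries fixed by [conj]. *)
Lemma exists_k_independent_normals (conj : {rmorphism F -> F}) r n k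
    (B : 'M[F]_(r, n)) :
  map_mx conj B = B ->
  (forall y : 'rV_n, (#|supp y| <= k)%N -> (y <= B)%MS -> y = 0) ->
  exists A : 'M[F]_(n, k),
    [/\ map_mx conj A = A, B *m A = 0 & k_independent k A].
Proof.
move=> Bconj Bmin; have [|t ht] := @k_independent_mul_moment n n k (cokermx B).
  by move=> y cy /eqP; rewrite -submxE; apply: Bmin.
exists (cokermx B *m moment_mx n k t); split=> //.
  rewrite map_mxM map_cokermx Bconj; congr (_ *m _).
  by apply/matrixP=> a b; rewrite !mxE rmorphXn /= rmorph_nat.
by rewrite mulmxA mulmx_coker mul0mx.
Qed.

Lemma k_independent_interp n k (A : 'M[F]_(n, k)) (K : {set 'I_n}) (f : 'I_n -> F) :
  k_independent k A -> (#|K| <= k)%N ->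
  exists y : 'rV_k, forall i, i \in K -> (y *m (row i A)^T) 0 0 = f i.
Proof.
move=> hA cK; pose E : 'M[F]_n := diag_mx (\row_i (i \in K)%:R).
have hE m (M : 'M[F]_(m, n)) i j : (M *m E) i j = M i j * (j \in K)%:R.
  by rewrite mul_mx_diag !mxE.
(* Each column of this product is, transposed, a relation between rows of [A] supported in K, hence
   zero. So the row space of [E] lies in that of [A^T *m E]. *)
have E0 : E *m cokermx (A^T *m E) = 0.
  apply: (can_inj (@trmxK _ _ _)); rewrite trmx0; apply/row_matrixP=> a.
  rewrite row0 trmx_mul tr_diag_mx row_mul; apply: hA.
    apply: leq_trans cK; apply: subset_leq_card; apply/subsetP => i.
    by rewrite inE hE; apply: contraNT => /negPf ->; rewrite mulr0.
  rewrite -!row_mul -(tr_diag_mx (\row_i (i \in K)%:R)) -[A]trmxK -!trmx_mul.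
  by rewrite trmxK mulmxA mulmx_coker trmx0 row0.
have /submxP [y hy] : (\row_i f i *m E <= A^T *m E)%MS.
  by rewrite submxE -mulmxA E0 mulmx0.
exists y => i iK; have /rowP/(_ i) := hy.
rewrite mulmxA !hE iK !mulr1 mxE => ->; rewrite !mxE.
by apply: eq_bigr => b _; rewrite !mxE.
Qed.

Lemma exists_relation n k (A : 'M[F]_(n, k)) (L : {set 'I_n}) :
  #|L| = k.+1 -> exists v, [/\ v != 0, supp v \subset L & v *m A = 0].
Proof.
move=> cL; pose S := \matrix_(a < #|L|) (delta_mx 0 (enum_val a) : 'rV[F]_n).
have SE (x : 'rV_#|L|) a : (x *m S) 0 (enum_val a) = x 0 a.
  rewrite mxE (bigD1 a) //= !mxE !eqxx mulr1 big1 ?addr0 // => b ba.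
  by rewrite !mxE (inj_eq enum_val_inj) eq_sym (negPf ba) mulr0.
have /rowV0Pn [x xk x0] : kermx (S *m A) != 0.
  rewrite kermx_eq0 /row_free neq_ltn (leq_trans _ (_ : k < _)%N) ?cL //.
  exact: rank_leq_col.
exists (x *m S); split.
- apply: contraNneq x0 => xS; apply/eqP/rowP=> a.
  by rewrite -SE xS !mxE.
- apply/subsetP => j; rewrite inE; apply: contraNT => jL.
  rewrite mxE big1 // => a _; rewrite !mxE /=; case: eqP => [E|]; rewrite ?mulr0 //.
  by move: jL; rewrite E enum_valP.
- by rewrite -mulmxA; apply/eqP; rewrite -sub_kermx.
Qed.

End Interpolation.

(** * The hyperplanes D_L *)

(** Rescales t_i to t_i |alpha_i|^2, the value at which <x, alpha_i> is constant on the i-th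
    translate when the normals are real. *)
Definition sqnorm_mx (F : fieldType) n k (A : 'M[F]_(n, k)) : 'M[F]_n :=
  diag_mx (\row_i (row i A *m (row i A)^T) 0 0).

Section Normals.
Variables (F : numFieldType) (conj : F -> F) (n k : nat) (A : 'M[F]_(n, k)).
Hypothesis conj_real : forall x, conj x = x -> x \is Num.real.
Hypothesis A_conj : map_mx conj A = A.
Hypothesis A_indep : k_independent k A.
Hypothesis k_gt0 : (0 < k)%N.

Let memH x i : (x \in hyperplane conj A i) = (x *m (row i A)^T == 0).
Proof. by rewrite memv_ker lfunE /= map_row A_conj. Qed.

Lemma k_independent_generic : generic_arrangement conj A.
Proof.
move=> I cI; pose N := \matrix_(a < #|I|) row (enum_val a) A.
apply: (@dim_ker F k #|I| N^T).
  rewrite /row_full mxrank_tr; rewrite -[_ == _]/(row_free N); apply: kernel0_row_free => x xN.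
  pose y := \sum_(a < #|I|) x 0 a *: (delta_mx 0 (enum_val a) : 'rV_n).
  have ya a : y 0 (enum_val a) = x 0 a.
    rewrite summxE (bigD1 a) //= !mxE !eqxx mulr1 big1 ?addr0 // => b ba.
    by rewrite !mxE (inj_eq enum_val_inj) eq_sym (negPf ba) mulr0.
  apply/rowP => a; rewrite -ya (_ : y = 0) ?mxE //; apply: A_indep.
    apply: leq_trans cI; apply: subset_leq_card; apply/subsetP => i.
    rewrite inE summxE; apply: contraNT => iI.
    rewrite big1 // => b _; rewrite !mxE /=; case: eqP => [E|]; rewrite ?mulr0 //.
    by move: iI; rewrite E enum_valP.
  rewrite -xN (mulmx_sum_row x) mulmx_suml; apply: eq_bigr => b _.
  by rewrite -scalemxAl -rowE rowK.
move=> x; rewrite (big_morph (fun V : {vspace _} => x \in V)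
  (fun U V => memv_cap x U V) (memvf x)) big_andE.
apply/forallP/eqP => [h|xN i]; last first.
  apply/implyP=> iI; rewrite memH; apply/eqP.
  have <- : row (enum_rank_in iI i) N = row i A by rewrite rowK enum_rankK_in.
  apply/matrixP => a b; rewrite !ord1 [RHS]mxE.
  have /rowP/(_ (enum_rank_in iI i)) := xN; rewrite !mxE => E.
  by rewrite -[RHS]E; apply: eq_bigr => c _; rewrite !mxE.
apply/rowP=> a; have := h (enum_val a); rewrite enum_valP memH => /eqP/matrixP/(_ 0 0).
rewrite !mxE => E; rewrite -[RHS]E.
by apply: eq_bigr => c _; rewrite !mxE.
Qed.

Let q i := (row i A *m (row i A)^T) 0 0.
Let Q := sqnorm_mx A.

(** The entries of [A] are fixed by [conj], hence real, and a sum of real squares vanishes only for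
    a zero row, which k > 0 excludes. *)
Lemma sqnorm_neq0 i : q i != 0.
Proof.
have conjA j : A i j \is Num.real.
  by apply: conj_real; move/matrixP/(_ i j): A_conj; rewrite mxE.
apply/eqP => qi.
have Ai : row i A = 0.
  have/eqP := qi; rewrite /q mxE psumr_eq0 => [/allP h|j _]; last first.
    by rewrite !mxE -expr2 -realEsqr.
  apply/rowP=> j; have := h j; rewrite mem_index_enum => /(_ isT).
  by rewrite !mxE -expr2 sqrf_eq0 => /eqP.
have /A_indep : (#|supp (delta_mx 0 i : 'rV[F]_n)%R| <= k)%N.
  apply: (@leq_trans #|[set i]%SET|); last by rewrite cards1.
  apply: subset_leq_card.
  apply/subsetP=> j; rewrite !inE mxE eqxx /=.
  by case: (j == i); rewrite ?eqxx.
rewrite -rowE => /(_ Ai) /rowP/(_ i); rewrite !mxE !eqxx => /eqP.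
by rewrite oner_eq0.
Qed.

Lemma sqnorm_mx_unit : Q \in unitmx.
Proof.
rewrite unitmxE det_diag unitfE; apply/prodf_neq0 => i _.
by rewrite mxE sqnorm_neq0.
Qed.

(** The i-th translate is the affine hyperplane y . alpha_i = t_i |alpha_i|^2. *)
Lemma D1P L t : D1 conj A L t <->
  exists y : 'rV_k, forall i, i \in L -> (y *m (row i A)^T) 0 0 = t 0 i * q i.
Proof.
split=> [[y hy]|[y hy]]; exists y => i iL; last first.
  exists (y - t 0 i *: row i A); last by rewrite subrK.
  rewrite /= memH mulmxBl -scalemxAl; apply/eqP/matrixP=> a b.
  by rewrite !ord1 [LHS]mxE hy // mxE [X in - X]mxE [RHS]mxE subrr.
have [x] := hy i iL; rewrite /= memH => /eqP xH <-.
by rewrite mulmxDl xH add0r -scalemxAl mxE.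
Qed.

(** A common point transfers the relation v from the normals to the levels. Conversely, without one
    index i0 of the support only k independent normals remain, so their levels are attained by some
    y, and the relation v then forces the right level at i0. *)
Lemma D1_relation (L : {set 'I_n}) (v t : 'rV[F]_n) :
  #|L| = k.+1 -> v != 0 -> supp v \subset L -> v *m A = 0 ->
  D1 conj A L t <-> t *m Q *m v^T = 0.
Proof.
move=> cL v0 vL vA.
have pairE : (t *m Q *m v^T) 0 0 = \sum_(i in L) t 0 i * q i * v 0 i.
  rewrite mxE [RHS]big_mkcond; apply: eq_bigr => i _.
  rewrite mul_mx_diag mxE [X in _ * X * _]mxE [X in _ * X]mxE.
  case: ifPn => // iL; have /eqP -> : v 0 i == 0; last by rewrite mulr0.
  by apply: contraR iL => vi; apply: (subsetP vL); rewrite inE.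
have pairy (y : 'rV_k) : \sum_(i in L) (y *m (row i A)^T) 0 0 * v 0 i = 0.
  transitivity ((y *m (v *m A)^T) 0 0); last by rewrite vA trmx0 mulmx0 mxE.
  rewrite trmx_mul mulmxA [RHS]mxE [LHS]big_mkcond; apply: eq_bigr => i _.
  rewrite !mxE; case: ifPn => [iL|iL].
    by congr (_ * _); apply: eq_bigr => j _; rewrite !mxE.
  have /eqP -> : v 0 i == 0; last by rewrite mulr0.
  by apply: contraR iL => vi; apply: (subsetP vL); rewrite inE.
split=> [/D1P [y hy]|].
  apply/matrixP=> a b; rewrite !ord1 pairE [RHS]mxE -[RHS](pairy y).
  by apply: eq_bigr => i iL; rewrite hy.
move=> /matrixP/(_ 0 0); rewrite pairE [RHS]mxE => tv; apply/D1P.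
have [i0 vi0] : exists i, v 0 i != 0.
  apply/existsP; rewrite -[[exists _, _]]negbK negb_exists; apply: contra v0.
  by move=> /forallP h; apply/eqP/rowP=> i; rewrite mxE; apply/eqP; rewrite -[_ == _]negbK.
have i0L : i0 \in L by apply: (subsetP vL); rewrite inE.
have [|y hy] := @k_independent_interp F n k A (L :\ i0) (fun i => t 0 i * q i) A_indep.
  by move: cL; rewrite (cardsD1 i0) i0L add1n => -[->].
exists y => i iL; case: (eqVneq i i0) => [->|ii0]; last by apply: hy; rewrite !inE ii0.
apply: (mulIf vi0); move: (pairy y); rewrite (bigD1 i0) //= => /eqP.
rewrite addr_eq0 => /eqP ->; move: tv; rewrite (bigD1 i0) //= => /eqP.
rewrite addr_eq0 => /eqP ->; congr (- _); apply: eq_bigr => j /andP [jL ji].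
by rewrite hy // !inE ji.
Qed.

End Normals.

(** * From codes to dense intersections *)

Lemma exists_subset (T : finType) m (S : {set T}) :
  (m <= #|S|)%N -> exists2 L : {set T}, L \subset S & #|L| = m.
Proof.
move=> /card_geqP [s [us <- sS]]; exists [set x in s]%SET.
  by apply/subsetP=> x; rewrite inE => /sS.
by rewrite cardsE; apply/card_uniqP.
Qed.

Section DenseOfCode.
Variables (F : numFieldType) (conj : F -> F) (n k : nat) (A : 'M[F]_(n, k)).
Hypothesis conj_real : forall x, conj x = x -> x \is Num.real.
Hypothesis A_conj : map_mx conj A = A.
Hypothesis A_indep : k_independent k A.
Hypothesis k_gt1 : (1 < k)%N.

(** Words are given by coefficient vectors: x stands for [x *m B], and the [rho i] are the minimal
    words. *)
Variables (B : 'M[F]_(k.+1, n)) (I : finType) (rho : I -> 'rV[F]_k.+1).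
Hypothesis BA : B *m A = 0.
Hypothesis supp_min : forall x, x != 0 -> (k < #|supp (x *m B)|)%N.
Hypothesis supp_rho : forall i, #|supp (rho i *m B)| = k.+1.
Hypothesis supp_eq : forall x, #|supp (x *m B)| = k.+1 ->
  exists i c, x = c *: rho i.
Hypothesis rho_indep : forall c : I -> F, (#|[set i | c i != 0%R]| <= k.+1)%N ->
  \sum_i c i *: rho i = 0 -> forall i, c i = 0.
Hypothesis card_I : #|I| = (k + k)%N.

Let Q := sqnorm_mx A.
Let S i := supp (rho i *m B).
Let annihilates (J : {set I}) (t : 'rV[F]_n) := forall i, i \in J -> t *m Q *m (rho i *m B)^T = 0.

Let k_gt0 : (0 < k)%N. Proof. exact: ltnW. Qed.

Lemma sum_delta (a : F) i : \sum_z (a * (z == i)%:R) *: rho z = a *: rho i.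
Proof.
rewrite (bigD1 i) //= eqxx mulr1 big1 ?addr0 // => z /negPf ->.
by rewrite mulr0 scale0r.
Qed.

(** Uses 3 <= k + 1. The case j = l is allowed and serves for relations between two words. *)
Lemma rho_indep3 a b c i j l : i != j -> i != l ->
  a *: rho i + b *: rho j + c *: rho l = 0 -> a = 0.
Proof.
move=> ij il E.
have := rho_indep (c := fun z => a * (z == i)%:R + b * (z == j)%:R + c * (z == l)%:R).
move=> /(_ _ _ i); rewrite eqxx (negPf ij) (negPf il) !mulr0 !addr0 mulr1; apply.
  apply: (@leq_trans #|[set i; j; l]%SET|).
    apply: subset_leq_card; apply/subsetP => z; rewrite !inE.
    apply: contraR; rewrite !negb_or => /andP [/andP [/negPf -> /negPf ->] /negPf ->].
    by rewrite !mulr0 !addr0.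
  rewrite -setUA !cardsU1 cards1 (@leq_trans 3) //.
  by rewrite (leq_add (leq_b1 _)) // (leq_add (leq_b1 _)).
rewrite -[RHS]E -!sum_delta -!big_split /=; apply: eq_bigr => z _.
by rewrite !scalerDl.
Qed.

Lemma small_supp x (M : {set 'I_n}) : (#|M| <= k)%N -> supp (x *m B) \subset M -> x = 0.
Proof.
move=> cM sM; apply/eqP; apply: contraT => /supp_min.
by rewrite ltnNge (leq_trans (subset_leq_card sM)).
Qed.

Lemma memS i a : (a \in S i) = ((rho i *m B) 0 a != 0).
Proof. by rewrite inE. Qed.

Lemma comb3 (u v w : 'rV[F]_n) (a b c : F) d :
  (a *: u + b *: v + c *: w) 0 d = a * u 0 d + b * v 0 d + c * w 0 d.
Proof. by rewrite !mxE. Qed.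

(** Two minimal words with the same support have a combination that vanishes at one of its points;
    its weight is at most k, so it is zero, against independence. *)
Lemma S_inj : injective S.
Proof.
move=> i j Sij; apply/eqP; apply: contraT => ij.
have /card_gt0P [a ai] : (0 < #|S i|)%N by rewrite supp_rho.
have aj : a \in S j by rewrite -Sij.
pose p z d := (rho z *m B) 0 d.
have x0 : p j a *: rho i + - p i a *: rho j + 0 *: rho j = 0.
  apply: (@small_supp _ (S i :\ a)).
    by rewrite -ltnS -(supp_rho i) (cardsD1 a (supp _)) ai.
  apply/subsetP => b; rewrite inE !mulmxDl -!scalemxAl comb3 -!/(p _ _).
  rewrite !inE -memS mul0r addr0; case: (eqVneq b a) => [->|ba /=].
    by rewrite mulrC mulNr subrr eqxx.
  apply: contraR => bi; have : b \notin S j by rewrite -Sij.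
  by move: bi; rewrite !memS !negbK /p => /eqP -> /eqP ->; rewrite !mulr0 addr0.
by move: aj; rewrite memS -/(p j a) (rho_indep3 ij ij x0) eqxx.
Qed.

(* Three words of weight k+1 with supports in a set of size k+2 could be
   combined into a nonzero word of weight at most k. *)
Lemma S_not_all (M : {set 'I_n}) : #|M| = k.+2 ->
  ~ (forall L : {set 'I_n}, L \subset M -> #|L| = k.+1 -> exists i, L = S i).
Proof.
move=> cM h; have : (2 < #|M|)%N by rewrite cM !ltnS.
case/card_gt2P => a [b [c [[aM bM cM'] [ab bc ca]]]].
have hD z : z \in M -> exists i, M :\ z = S i.
  by move=> zM; apply: h; [apply: subsetDl|move: cM; rewrite (cardsD1 z) zM => -[]].
have [[i iE] [j jE] [l lE]] := And3 (hD a aM) (hD b bM) (hD c cM').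
pose p z d := (rho z *m B) 0 d.
have pE z y d : M :\ y = S z -> (p z d != 0) = (d != y) && (d \in M).
  by move=> E; rewrite -[LHS]memS -E !inE.
have p0 z y d : M :\ y = S z -> (d == y) || (d \notin M) -> p z d = 0.
  by move=> E dy; apply/eqP; rewrite -[_ == _]negbK (pE _ _ _ E) negb_and !negbK.
(* The coefficients cancel the coordinates a and b, leaving at most k points in the support; that of
   [rho l] is nonzero. *)
have x0 : (p i b * p j a) *: rho l + - (p l b * p j a) *: rho i
    + - (p l a * p i b) *: rho j = 0.
  apply: (@small_supp _ (M :\ a :\ b)).
    move: cM; rewrite (cardsD1 a) aM (cardsD1 b (M :\ a)) !inE bM eq_sym ab.
    by rewrite !add1n => -[->].
  apply/subsetP => d; rewrite inE !mulmxDl -!scalemxAl comb3 -!/(p _ _).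
  rewrite !inE; case: (eqVneq d b) => [->|db].
    by rewrite (p0 _ _ b jE) ?eqxx // => /negP[]; apply/eqP; ring.
  case: (eqVneq d a) => [->|da].
    by rewrite (p0 _ _ a iE) ?eqxx // => /negP[]; apply/eqP; ring.
  apply: contraR => /= dM.
  by rewrite (p0 _ _ d iE) ?(p0 _ _ d jE) ?(p0 _ _ d lE) ?dM ?orbT // !mulr0 !addr0.
have S_neq z y u w : M :\ z = S u -> M :\ y = S w -> z \in M -> z != y -> u != w.
  move=> zu yw zM; apply: contra_neq => uw; apply/eqP; apply: contraT => zy.
  have : z \in M :\ y by rewrite !inE zy.
  by rewrite yw -uw -zu !inE eqxx.
have := rho_indep3 (S_neq _ _ _ _ lE iE cM' ca) (S_neq _ _ _ _ lE jE cM' _) x0.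
rewrite eq_sym bc => /(_ isT) /eqP; rewrite mulf_eq0 -[_ || _]negbK negb_or.
by rewrite (pE _ _ _ iE) (pE _ _ _ jE) aM bM ab eq_sym ab.
Qed.

Lemma D1_S t i : D1 conj A (S i) t <-> t *m Q *m (rho i *m B)^T = 0.
Proof.
apply: (D1_relation A_conj A_indep); rewrite ?supp_rho //.
  by apply: contra_eq_neq (supp_rho i) => ->; rewrite supp0 cards0.
by rewrite -mulmxA BA mulmx0.
Qed.

(** By duality the relation supported on L is a combination of the words in J. It is thus a nonzero
    word of weight at most k + 1, hence a multiple of a minimal one. *)
Lemma sub_D1 J (L : {set 'I_n}) : #|L| = k.+1 ->
  (forall t, annihilates J t -> D1 conj A L t) ->
  exists2 i, L = S i & (#|J| <= k)%N -> i \in J.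
Proof.
move=> cL hL; have [v [v0 vL vA]] := exists_relation A cL.
pose M := (\sum_(i in J) <<rho i *m B>>)%MS.
have vM : (v <= M)%MS.
  rewrite submxE; apply/eqP; apply: (can_inj (@trmxK _ _ _)); rewrite trmx0 trmx_mul.
  apply/row_matrixP => a; rewrite row0 row_mul.
  (* Test points: the columns of the cokernel of [M], rescaled, are orthogonal to all words in J, so
     they lie in D_L. *)
  pose t := row a (cokermx M)^T *m invmx Q.
  have tQ : t *m Q = row a (cokermx M)^T.
    by rewrite mulmxKV // (sqnorm_mx_unit conj_real A_conj A_indep k_gt0).
  rewrite -tQ; apply/(D1_relation A_conj A_indep _ cL) => //.
  apply: hL => i iJ; rewrite tQ -row_mul -trmx_mul.
  have /eqP -> : rho i *m B *m cokermx M == 0.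
    by rewrite -submxE; apply: (sumsmx_sup i) => //; rewrite genmxE.
  by rewrite trmx0 row0.
have [u uE] := sub_sumsmxP vM.
have /fin_all_exists [c hc] i : exists c, u i *m <<rho i *m B>>%MS = c *: (rho i *m B).
  by apply/sub_rVP; rewrite -(genmxE (rho i *m B)) submxMl.
pose x := \sum_(i in J) c i *: rho i.
have vE : v = x *m B.
  rewrite uE mulmx_suml; apply: eq_bigr => i _.
  by rewrite hc scalemxAl.
have x0 : x != 0 by apply: contraNneq v0 => x0; rewrite vE x0 mul0mx.
have sL : supp v = L.
  by apply/eqP; rewrite eqEcard vL cL vE supp_min.
have [|i [d xE]] := @supp_eq x; first by rewrite -vE sL.
have d0 : d != 0 by apply: contraNneq x0 => d0; rewrite xE d0 scale0r.
exists i; first by rewrite -sL vE xE -scalemxAl suppZ.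
move=> cJ; apply: contraT => iJ.
(* For i outside J, the two expressions of x give a relation between at most k + 1 of the [rho],
   with coefficient - d at i. *)
have := rho_indep (c := fun z => if z == i then - d else if z \in J then c z else 0).
move=> /(_ _ _ i); rewrite eqxx => E; move: d0; rewrite -oppr_eq0 => /eqP[]; apply: E.
  apply: (@leq_trans #|i |: J|); last by rewrite cardsU1 iJ add1n ltnS.
  apply: subset_leq_card; apply/subsetP => z; rewrite !inE.
  by case: (eqVneq z i) => //= _; case: ifP => // _; rewrite eqxx.
rewrite (bigD1 i) //= eqxx scaleNr -xE /x [in X in X + _]big_mkcond (bigD1 i) //=.
rewrite (negPf iJ) add0r addrC; apply/eqP; rewrite subr_eq0; apply/eqP.
by apply: eq_bigr => z /negPf ->; case: ifP => // _; rewrite scale0r.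
Qed.

Lemma rho_row_free (J : {set I}) : (#|J| <= k.+1)%N ->
  row_free (\matrix_(a < #|J|) rho (enum_val a)).
Proof.
move=> cJ; apply: kernel0_row_free => x xR.
pose c i := \sum_a x 0 a * (enum_val a == i)%:R.
have cE a : c (enum_val a) = x 0 a.
  rewrite /c (bigD1 a) //= eqxx mulr1 big1 ?addr0 // => b ba.
  by rewrite (inj_eq enum_val_inj) (negPf ba) mulr0.
apply/rowP => a; rewrite -cE mxE; apply: rho_indep.
  apply: leq_trans cJ; apply: subset_leq_card; apply/subsetP => i.
  rewrite inE; apply: contraNT => iJ; rewrite /c big1 // => b _.
  by case: eqP => [E|]; rewrite ?mulr0 //; move: iJ; rewrite -E enum_valP.
transitivity (\sum_i \sum_a (x 0 a * (enum_val a == i)%:R) *: rho i).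
  by apply: eq_bigr => i _; rewrite scaler_suml.
rewrite -[RHS]xR mulmx_sum_row exchange_big; apply: eq_bigr => b _; rewrite rowK -sum_delta.
by apply: eq_bigr => z _; rewrite eq_sym.
Qed.

(** Any k + 1 of the [rho] form a basis of the coefficient space, so they annihilate as much as the
    whole code. *)
Lemma annihilates_all (J : {set I}) t : (k < #|J|)%N -> annihilates J t ->
  t *m (Q *m B^T) = 0.
Proof.
move=> cJ; have [J' sJ cJ'] := exists_subset cJ => hJ.
pose R := \matrix_(a < #|J'|) rho (enum_val a).
have /row_fullP [R' R'R] : row_full R.
  by rewrite /row_full (eqP (rho_row_free _)) cJ'.
rewrite -[B]mul1mx -R'R -mulmxA trmx_mul !mulmxA (_ : _ *m (R *m B)^T = 0) ?mul0mx //.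
apply: (can_inj (@trmxK _ _ _)); rewrite trmx0 trmx_mul trmxK.
apply/row_matrixP => a; rewrite row0 !row_mul rowK.
apply: (can_inj (@trmxK _ _ _)); rewrite trmx_mul trmxK trmx0.
by apply: hJ; apply: (subsetP sJ); apply: enum_valP.
Qed.

(** A component with at least k + 2 indices contradicts [S_not_all]; the others are supports of
    minimal words, found by [sub_D1]. For k < #|J| < 2k the words in J already span the code, so all
    2k supports would be components: hence the two cases. *)
Lemma canonical_presentationE (Y : {vspace 'rV[F]_n}) (J : {set I}) :
  (#|J| <= k)%N \/ J = [set: I]%SET ->
  (forall t, t \in Y <-> annihilates J t) ->
  canonical_presentation conj A Y = [set S i | i in J]%SET.
Proof.
move=> hJ hY; have subD1 (L : {set 'I_n}) : #|L| = k.+1 ->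
    ([set` Y] `<=` D1 conj A L)%classic -> exists2 i, i \in J & L = S i.
  move=> cL YL; have [t /hY|i -> iJ] := @sub_D1 J L cL; first exact: YL.
  by exists i => //; case: hJ => [/iJ //|->]; rewrite inE.
have big_false (T : {set 'I_n}) : (k.+1 < #|T|)%N -> ~ ([set` Y] `<=` D conj A T)%classic.
  move=> cT YT; have [M MT cM] := exists_subset cT.
  apply: (S_not_all cM) => L LM cL; have [|i _ ->] := @subD1 L cL; last by exists i.
  by move=> t /YT; apply; rewrite /= (subset_trans LM MT) cL eqxx.
apply/setP => T; rewrite inE; apply/asboolP/imsetP => [[cT YT _]|[i iJ ->]].
  have cT' : #|T| = k.+1.
    by apply/eqP; rewrite eqn_leq cT andbT leqNgt; apply/negP => /big_false.
  have [|i iJ ->] := @subD1 T cT'; last by exists i.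
  by move=> t /YT; apply; rewrite /= subxx cT' eqxx.
split; first by rewrite supp_rho.
  move=> t /hY tJ L /= /andP [LS /eqP cL].
  have -> : L = S i by apply/eqP; rewrite eqEcard LS cL supp_rho leqnn.
  by apply/D1_S/tJ.
by move=> j jS; apply: big_false; rewrite cardsU1 jS supp_rho.
Qed.

Lemma athanasiadis_rankE (Y : {vspace 'rV[F]_n}) (J : {set I}) :
  (#|J| <= k)%N \/ J = [set: I]%SET ->
  (forall t, t \in Y <-> annihilates J t) -> athanasiadis_rank conj A Y = #|J|.
Proof.
move=> hJ hY; rewrite /athanasiadis_rank (canonical_presentationE hJ hY).
rewrite big_imset /=; last by move=> i j _ _; apply: S_inj.
by rewrite -sum1_card; apply: eq_bigr => i _; rewrite supp_rho subSn // subnn.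
Qed.

Lemma row_full_QT m (P : 'M[F]_(m, n)) : row_free P -> row_full (Q *m P^T).
Proof.
move=> fP; rewrite /row_full -mxrank_tr trmx_mul trmxK mxrankMfree ?(eqP fP) //.
by rewrite row_free_unit unitmx_tr (sqnorm_mx_unit conj_real A_conj A_indep k_gt0).
Qed.

Lemma B_free : row_free B.
Proof.
apply: kernel0_row_free => x xB; apply/eqP; apply: contraT => /supp_min.
by rewrite xB supp0 cards0.
Qed.

Lemma codim_annihilates (Y : {vspace 'rV[F]_n}) (J : {set I}) :
  (#|J| <= k)%N -> (forall t, t \in Y <-> annihilates J t) -> codim Y = #|J|.
Proof.
move=> cJ hY; pose R := \matrix_(a < #|J|) rho (enum_val a).
have YE t : (t \in Y) = (t *m (Q *m (R *m B)^T) == 0).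
  apply/idP/eqP => [/hY tJ|tR].
    rewrite mulmxA; apply: (can_inj (@trmxK _ _ _)); rewrite trmx0 trmx_mul trmxK.
    apply/row_matrixP => a; rewrite row0 !row_mul rowK.
    apply: (can_inj (@trmxK _ _ _)); rewrite trmx_mul trmxK trmx0.
    by apply: tJ; apply: enum_valP.
  apply/hY => i iJ.
  have <- : row (enum_rank_in iJ i) (R *m B) = rho i *m B.
    by rewrite row_mul rowK enum_rankK_in.
  by rewrite rowE trmx_mul mulmxA -[t *m Q *m _]mulmxA tR mul0mx.
rewrite /codim -[X in (X - _)%N](dim_ker (row_full_QT _) YE) ?addKn //.
apply: kernel0_row_free => x; rewrite mulmxA => xRB.
have xR : x *m R = 0.
  apply/eqP; apply: contraT => /supp_min.
  by rewrite xRB supp0 cards0.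
apply/eqP; rewrite -(mulmx_free_eq0 _ (rho_row_free _)) ?(leq_trans cJ) //.
by rewrite xR.
Qed.

Let X : {vspace 'rV[F]_n} := lker (linfun (mulmxr (Q *m B^T) : 'rV[F]_n -> 'rV[F]_k.+1)).

Let memX t : (t \in X) = (t *m (Q *m B^T) == 0).
Proof. by rewrite memv_ker lfunE. Qed.

Let XP t : t \in X <-> annihilates [set: I]%SET t.
Proof.
rewrite memX; split=> [/eqP tB i _|].
  by rewrite trmx_mul mulmxA -[t *m Q *m _]mulmxA tB mul0mx.
by move=> tI; apply/eqP/(annihilates_all _ tI); rewrite cardsT card_I -addn1 leq_add.
Qed.

Lemma codim_X : codim X = k.+1.
Proof.
by rewrite /codim -[X in (X - _)%N](dim_ker (row_full_QT B_free) memX) addKn.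
Qed.

Lemma athanasiadis_rank_X : athanasiadis_rank conj A X = (k + k)%N.
Proof. by rewrite (athanasiadis_rankE _ XP) ?cardsT ?card_I //; right. Qed.

Lemma X_in_lattice : in_lattice conj A X.
Proof.
exists [set S i | i in [set: I]]%SET.
  by move=> _ /imsetP [i _ ->]; rewrite supp_rho.
apply/seteqP; split=> t /=.
  by move=> /XP tX _ /imsetP [i iI ->]; apply/D1_S/tX.
by move=> h; apply/XP => i iI; apply/D1_S/h/imset_f.
Qed.

Lemma dense_of_code : dense_intersection conj A X.
Proof.
have nvg : ~ very_generic conj A X.
  rewrite /very_generic codim_X athanasiadis_rank_X => /eqP.
  by rewrite -addn1 eqn_add2l eq_sym gtn_eqF.
split; last first.
  by rewrite codim_X athanasiadis_rank_X subn1 addSn -addnS prednK.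
split=> //; first exact: X_in_lattice.
move=> Y [T cT YT] XY YX; pose J := [set i | S i \in T]%SET.
have hT L : L \in T -> exists i, L = S i.
  move=> LT; have [t /XP|i ->] := @sub_D1 [set: I]%SET L (cT L LT); last by exists i.
  by move/(subvP XY) => tY; have : [set` Y]%classic t by []; rewrite YT; apply.
have hY t : t \in Y <-> annihilates J t.
  have -> : (t \in Y : Prop) = (\bigcap_(L in [set` T]) D1 conj A L)%classic t.
    by rewrite -YT.
  split=> [h i|h L /= LT]; first by rewrite inE => iT; apply/D1_S/h.
  have [i Li] := hT L LT; rewrite Li; apply/D1_S/h.
  by rewrite inE -Li.
(* More than k words span the whole code, which would make Y equal to X. *)
have cJ : (#|J| <= k)%N.
  rewrite leqNgt; apply/negP => cJ; apply: YX; apply/vspaceP => t.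
  apply/idP/idP => [/hY tJ|]; last exact: (subvP XY).
  by rewrite memX; apply/eqP/(annihilates_all cJ).
by rewrite /very_generic (codim_annihilates cJ hY) (athanasiadis_rankE _ hY) //; left.
Qed.

Lemma dense_of_code_arrangement :
  [/\ generic_arrangement conj A, non_very_generic_arrangement conj A &
        exists X, dense_intersection conj A X].
Proof.
split; first exact: k_independent_generic.
  by exists X; case: dense_of_code => -[].
by exists X; apply: dense_of_code.
Qed.

End DenseOfCode.

(** * Arrangements of any larger size from one code *)

Definition dense_code (F : fieldType) k n (B : 'M[F]_(k.+1, n)) (I : finType)
    (rho : I -> 'rV[F]_k.+1) : Prop :=
  [/\ #|I| = (k + k)%N,
      forall x, x != 0 -> (k < #|supp (x *m B)|)%N,
      forall i, #|supp (rho i *m B)| = k.+1,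
      forall x, #|supp (x *m B)| = k.+1 -> exists i c, x = c *: rho i &
      forall c : I -> F, (#|[set i | c i != 0%R]| <= k.+1)%N ->
        \sum_i c i *: rho i = 0 -> forall i, c i = 0].

(** Zero columns change no weight, so the code can be lengthened at will; the additional normals are
    still chosen in general position. *)
Lemma dense_code_arrangement (F : numFieldType) (conj : {rmorphism F -> F}) k n l
    (B : 'M[F]_(k.+1, n)) (I : finType) (rho : I -> 'rV[F]_k.+1) :
  (forall x, conj x = x -> x \is Num.real) -> (1 < k)%N ->
  map_mx conj B = B -> dense_code B rho ->
  exists_dense_arrangement conj k (n + l).
Proof.
move=> conj_real k1 Bconj [cI Bmin Brho Beq indep].
pose B' : 'M_(k.+1, n + l) := row_mx B 0.
have suppB' x : #|supp (x *m B')| = #|supp (x *m B)|.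
  by rewrite mul_mx_row mulmx0 card_supp_row_mx supp0 cards0 addn0.
have B'conj : map_mx conj B' = B' by rewrite map_row_mx Bconj map_mx0.
have [|A [Aconj BA Aind]] := @exists_k_independent_normals F conj k.+1 (n + l) k B' B'conj.
  move=> y cy /submxP [x yE]; rewrite yE in cy *.
  have [->|/Bmin] := eqVneq x 0; first by rewrite mul0mx.
  by rewrite -suppB' ltnNge cy.
split.
  have /card_gt0P [i _] : (0 < #|I|)%N by rewrite cI addn_gt0 (ltnW k1).
  by rewrite -(Brho i) (leq_trans (max_card _)) // card_ord leq_addr.
exists A; apply: (@dense_of_code_arrangement _ _ _ _ _ _ _ _ _ B' I rho) => //.
- by move=> x; rewrite suppB'; apply: Bmin.
- by move=> i; rewrite suppB'.
- by move=> x; rewrite suppB'; apply: Beq.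
Qed.

(** * The code for k >= 3 *)

(** Uniqueness of base 3 digits: reduction modulo 3 isolates the lowest one. *)
Lemma ternary_inj k (f g : 'I_k -> nat) :
  (forall j, f j < 3)%N -> (forall j, g j < 3)%N ->
  (\sum_j f j * 3 ^ j = \sum_j g j * 3 ^ j)%N -> f =1 g.
Proof.
elim: k f g => [|k IHk] f g hf hg; first by move=> _ [].
rewrite !big_ord_recl !expn0 !muln1.
under eq_bigr do rewrite expnS mulnCA.
under [X in _ = (_ + X)%N -> _]eq_bigr do rewrite expnS mulnCA.
rewrite -!big_distrr /= => E.
have E0 : f ord0 = g ord0.
  by have := congr1 (modn^~ 3%N) E; rewrite /= ![(3 * _)%N]mulnC ![(_ + _ * 3)%N]addnC !modnMDl !modn_small.
move: E; rewrite E0 => /addnI/eqP; rewrite eqn_mul2l /= => /eqP /IHk E j.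
case: (unliftP ord0 j) => [i|] -> //; apply: (E _ _ i) => {}i; [exact: hf|exact: hg].
Qed.

(** * Lagrange polynomials *)

Section Lagrange.
Variables (F : fieldType) (k : nat) (z : 'I_k -> F).
Hypothesis z_inj : injective z.

(** The Lagrange basis at the nodes z, left monic instead of normalized to value 1 at z a. *)
Definition ell a : {poly F} := \prod_(b | b != a) ('X - (z b)%:P).

Lemma ell_monic a : ell a \is monic.
Proof. by apply: monic_prod => b _; apply: monicXsubC. Qed.

Lemma mul_ell a : ('X - (z a)%:P) * ell a = \prod_b ('X - (z b)%:P).
Proof. by rewrite [RHS](bigD1 a). Qed.

Lemma size_ell a : size (ell a) = k.
Proof.
have := congr1 (fun p : {poly F} => size p) (mul_ell a).
rewrite size_prod_XsubC /index_enum -enumT size_enum_ord.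
rewrite size_monicM ?monicXsubC ?monic_neq0 ?ell_monic // size_XsubC /= add1n.
by case.
Qed.

Lemma horner_ell a b : ((ell a).[z b] == 0) = (b != a).
Proof.
rewrite /ell horner_prod; apply/prodf_eq0/idP => [[c ca]|ba]; last first.
  by exists b; rewrite ?hornerXsubC ?subrr.
by rewrite hornerXsubC subr_eq0 => /eqP /z_inj ->.
Qed.

Lemma horner_sum_ell (c : 'I_k -> F) b :
  ((\sum_a c a *: ell a).[z b] == 0) = (c b == 0).
Proof.
rewrite horner_sum (bigD1 b) //= big1 ?addr0 => [|a ab].
  by rewrite hornerZ mulf_eq0 horner_ell eqxx orbF.
by rewrite hornerZ; apply/eqP; rewrite mulf_eq0 horner_ell (eq_sym b) ab orbT.
Qed.

(** The [ell a] are monic of degree k - 1, so the sum of the c a is the coefficient of degree k -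
    1. *)
Lemma size_sum_ell (c : 'I_k -> F) :
  \sum_a c a = 0 -> (size (\sum_a c a *: ell a)%R <= k.-1)%N.
Proof.
move=> c0; apply/leq_sizeP => j kj; rewrite coef_sum.
have [->|jk] := eqVneq j k.-1.
  rewrite -[RHS]c0; apply: eq_bigr => a _; rewrite coefZ -(size_ell a) -lead_coefE.
  by rewrite (monicP (ell_monic a)) mulr1.
apply: big1 => a _; rewrite coefZ nth_default ?mulr0 // size_ell.
by case: k kj jk => // n; rewrite leq_eqVlt eq_sym => /predU1P[->|//]; rewrite eqxx.
Qed.
End Lagrange.

(** * Polynomials evaluated at the pairs w_j, w_j + 1 *)

Section ShiftedPairs.
Variables (F : numFieldType) (k : nat).
Hypothesis k_gt2 : (2 < k)%N.

(** In a sum of k of the points, the number of second points, at most k, is read modulo k + 1; the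
    number of points from each pair, at most 2, is then a base 3 digit. *)
Let w (j : 'I_k) : nat := (k.+1 * 3 ^ j)%N.
Let W : nat := (\sum_j w j)%N.
Let z0 j : F := (w j)%:R.
Let z1 j : F := (w j).+1%:R.
Let k_gt0 : (0 < k)%N. Proof. exact: leq_trans k_gt2. Qed.

Let z1E j : z1 j = z0 j + 1.
Proof. by rewrite /z1 -addn1 natrD. Qed.

Lemma z0_inj : injective z0.
Proof.
move=> i j /eqP; rewrite eqr_nat eqn_mul2l /= eqn_exp2l // => /eqP.
exact: val_inj.
Qed.

Lemma z1_inj : injective z1.
Proof. by move=> i j /eqP; rewrite eqr_nat eqSS -(eqr_nat F) => /eqP /z0_inj. Qed.

Lemma z0_neq_z1 i j : z0 i != z1 j.
Proof.
rewrite eqr_nat; apply/eqP => /(congr1 (modn^~ k.+1)).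
by rewrite /w ![(k.+1 * _)%N]mulnC modnMl -addn1 modnMDl modn_small.
Qed.

Definition roots0 (p : {poly F}) := [set j | root p (z0 j)].
Definition roots1 (p : {poly F}) := [set j | root p (z1 j)].

Lemma card_roots p : p != 0 -> (#|roots0 p| + #|roots1 p| < size p)%N.
Proof.
move=> p0; pose rs := [seq z0 j | j in roots0 p] ++ [seq z1 j | j in roots1 p].
have := @max_poly_roots _ p rs p0; rewrite size_cat !size_map -!cardE; apply.
  by rewrite all_cat !all_map; apply/andP; split; apply/allP=> j; rewrite mem_enum inE.
rewrite cat_uniq !map_inj_uniq ?enum_uniq //=; try exact: z0_inj; try exact: z1_inj.
rewrite andbT; apply/hasPn => _ /mapP [j _ ->]; apply/mapP => -[i _ /eqP].
by rewrite eq_sym (negPf (z0_neq_z1 _ _)).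
Qed.

(** T is the set of pairs whose second point is taken. *)
Let zz (T : {set 'I_k}) j := if j \in T then z1 j else z0 j.

Definition pair_poly T : {poly F} := \prod_j ('X - (zz T j)%:P).

Lemma zz_inj T : injective (zz T).
Proof.
move=> i j; rewrite /zz; case: ifP => _; case: ifP => _; [exact: z1_inj| | |exact: z0_inj].
  by move/eqP; rewrite eq_sym (negPf (z0_neq_z1 _ _)).
by move/eqP; rewrite (negPf (z0_neq_z1 _ _)).
Qed.

Lemma size_pair_poly T : size (pair_poly T) = k.+1.
Proof. by rewrite size_prod_XsubC /index_enum -enumT size_enum_ord. Qed.

Lemma pair_poly_monic T : pair_poly T \is monic.
Proof. by apply: monic_prod => b _; apply: monicXsubC. Qed.

Lemma coef_pair_poly T : (pair_poly T)`_k = 1.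
Proof.
by have /monicP := pair_poly_monic T; rewrite lead_coefE size_pair_poly.
Qed.

Lemma coefP_pair_poly T : (pair_poly T)`_k.-1 = - (W + #|T|)%:R.
Proof.
pose rs := [seq zz T j | j : 'I_k].
have srs : size rs = k by rewrite size_image card_ord.
have -> : pair_poly T = \prod_(z <- rs) ('X - z%:P) by rewrite big_map big_enum.
rewrite -[X in X.-1]srs coefPn_prod_XsubC ?srs -?lt0n //; congr (- _).
rewrite big_map big_enum /= natrD natr_sum -sum1_card natr_sum.
rewrite [X in _ + X]big_mkcond -big_split /=; apply: eq_bigr => j _.
by rewrite /zz; case: ifP; rewrite ?addr0.
Qed.

Lemma roots_pair_poly T :
  roots0 (pair_poly T) = ~: T /\ roots1 (pair_poly T) = T.
Proof.
have rootE x : root (pair_poly T) x = [exists j, x == zz T j].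
  rewrite /root horner_prod; apply/prodf_eq0/existsP => [[j _]|[j /eqP ->]].
    by rewrite hornerXsubC subr_eq0; exists j.
  by exists j; rewrite ?hornerXsubC ?subrr.
split; apply/setP => j; rewrite !inE rootE.
  apply/existsP/idP => [[i ij]|jT]; last by exists j; rewrite /zz (negPf jT).
  move: ij; rewrite /zz; case: ifPn => [_ |iT]; first by rewrite (negPf (z0_neq_z1 _ _)).
  by move/eqP/z0_inj->.
apply/existsP/idP => [[i ij]|jT]; last by exists j; rewrite /zz jT.
move: ij; rewrite /zz; case: ifPn => [iT| _]; last by rewrite eq_sym (negPf (z0_neq_z1 _ _)).
by move/eqP/z1_inj->.
Qed.

(** With k roots among the nodes, p has degree k and no other root, and the last hypothesis says
    that its roots sum to W + d. The choice of the w_j then leaves one root in each pair, d of them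
    being second points. *)
Lemma pair_polyP (p : {poly F}) d :
  p != 0 -> (size p <= k.+1)%N -> (#|roots0 p| + #|roots1 p| = k)%N ->
  (d <= k)%N -> p`_k.-1 + (W + d)%:R * p`_k = 0 ->
  exists2 T : {set 'I_k}, #|T| = d & p = p`_k *: pair_poly T.
Proof.
move=> p0 sp cr dk hp.
have sp' : size p = k.+1.
  by apply/eqP; rewrite eqn_leq sp -{1}cr card_roots.
pose rs := [seq z0 j | j in roots0 p] ++ [seq z1 j | j in roots1 p].
have srs : size rs = k by rewrite size_cat !size_map -!cardE.
have pE : p = lead_coef p *: \prod_(z <- rs) ('X - z%:P).
  apply: all_roots_prod_XsubC; rewrite ?srs // ?uniq_rootsE.
    by rewrite all_cat !all_map; apply/andP; split; apply/allP=> j; rewrite mem_enum inE.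
  rewrite cat_uniq !map_inj_uniq ?enum_uniq //=; try exact: z0_inj; try exact: z1_inj.
  rewrite andbT; apply/hasPn => _ /mapP [j _ ->]; apply/mapP => -[i _ /eqP].
  by rewrite eq_sym (negPf (z0_neq_z1 _ _)).
have lp : lead_coef p = p`_k by rewrite lead_coefE sp'.
have pk0 : p`_k != 0 by rewrite -lp lead_coef_eq0.
have sumE : \sum_(z <- rs) z = (W + d)%:R.
  have pk1 : p`_k.-1 = - p`_k * \sum_(z <- rs) z.
    rewrite {1}pE lp coefZ -{2}srs coefPn_prod_XsubC ?srs -?lt0n //.
    by rewrite mulrN mulNr.
  apply: (mulfI pk0); move/eqP: hp; rewrite pk1 mulNr addrC subr_eq0 => /eqP <-.
  by rewrite mulrC.
pose m (j : 'I_k) := ((j \in roots0 p) + (j \in roots1 p))%N.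
have sE : \sum_(z <- rs) z = \sum_j (m j)%:R * z0 j + #|roots1 p|%:R.
  rewrite big_cat !big_map !big_enum /= -sum1_card natr_sum.
  rewrite ![\sum_(j in _) _]big_mkcond -!big_split /=; apply: eq_bigr => j _.
  rewrite /m natrD mulrDl -addrA; case: (j \in roots0 p); case: (j \in roots1 p).
  - by rewrite !mul1r z1E.
  - by rewrite mul1r mul0r !addr0.
  - by rewrite mul0r mul1r z1E ?add0r.
  - by rewrite !mul0r !addr0.
(* The sum of the roots computed in two ways, as an identity of naturals: modulo k + 1 it gives
   [cd], and comparison of base 3 digits gives [m1]. *)
have mE : (k.+1 * (\sum_(j < k) m j * 3 ^ j) + #|roots1 p|
    = k.+1 * (\sum_(j < k) 1 * 3 ^ j) + d)%N.
  apply/eqP; rewrite -(eqr_nat F).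
  have -> : (k.+1 * (\sum_(j < k) 1 * 3 ^ j) = W)%N.
    by rewrite big_distrr /=; apply: eq_bigr => j _; rewrite mul1n.
  rewrite -sumE sE big_distrr /= natrD natr_sum (inj_eq (addIr _)).
  by apply/eqP/eq_bigr => j _; rewrite mulnCA natrM.
have c1 : (#|roots1 p| <= k)%N by rewrite -[X in (_ <= X)%N](card_ord k) max_card.
have cd : #|roots1 p| = d.
  have := congr1 (modn^~ k.+1) mE; rewrite /= ![(k.+1 * _)%N]mulnC !modnMDl.
  by rewrite !modn_small.
have m1 : m =1 fun=> 1%N.
  apply: ternary_inj => [j|//|]; first by rewrite /m; do 2 case: (_ \in _).
  by move/eqP: mE; rewrite cd eqn_add2r eqn_mul2l /= => /eqP.
exists (roots1 p) => //; rewrite -lp.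
apply: etrans (all_roots_prod_XsubC (rs := [seq zz (roots1 p) j | j : 'I_k]) _ _ _) _.
- by rewrite size_image card_ord.
- apply/allP => _ /mapP [j _ ->]; rewrite /zz; case: ifPn; first by rewrite inE.
  by move: (m1 j); rewrite /m => /[swap] /negPf ->; rewrite inE; case: root.
- by rewrite uniq_rootsE map_inj_uniq ?enum_uniq //; apply: zz_inj.
by rewrite big_map big_enum.
Qed.

(** By Vieta, for p of degree k this vanishes exactly when the roots of p, in a splitting field and
    with multiplicity, sum to W + d. *)
Definition psi d (p : {poly F}) : F := p`_k.-1 + (W + d)%:R * p`_k.

Lemma psi_pair_poly d T : (psi d (pair_poly T) == 0) = (#|T| == d).
Proof.
rewrite /psi coef_pair_poly coefP_pair_poly mulr1 addrC subr_eq0 eqr_nat.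
by rewrite eqn_add2l eq_sym.
Qed.

(** Here k > 2 enters: the two functionals [psi 1] and [psi k.-1] are distinct. *)
Let k1_neq1 : k.-1 != 1%N.
Proof. by case: k k_gt2 => [|[|[]]]. Qed.

Lemma psi_eq0 (p : {poly F}) : psi 1 p = 0 -> psi k.-1 p = 0 ->
  p`_k = 0 /\ p`_k.-1 = 0.
Proof.
rewrite /psi => p1 p2; have pk : p`_k = 0.
  have : ((W + 1)%:R - (W + k.-1)%:R) * p`_k = 0.
    rewrite mulrBl; apply/eqP; rewrite subr_eq0; apply/eqP/(addrI p`_k.-1).
    by rewrite p1 p2.
  move/eqP; rewrite mulf_eq0 subr_eq0 eqr_nat eqn_add2l eq_sym (negPf k1_neq1) /=.
  by move/eqP.
by move: p1; rewrite pk mulr0 addr0.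
Qed.

(** Sends the coefficients of p to its values at the w_j, its values at the w_j + 1, and finally
    [psi 1 p] and [psi k.-1 p]. *)
Definition shifted_pairs_mx : 'M[F]_(k.+1, (k + k) + 2) :=
  row_mx (row_mx (\matrix_(a, j) z0 j ^+ a) (\matrix_(a, j) z1 j ^+ a))
    (\matrix_(a, j) ((a == k.-1 :> nat)%:R
      + (W + (if j == 0 then 1 else k.-1))%:R * (a == k :> nat)%:R)).

Let B := shifted_pairs_mx.

Lemma shifted_pairs_mx_conj (conj : {rmorphism F -> F}) : map_mx conj B = B.
Proof.
rewrite !map_row_mx; congr (row_mx (row_mx _ _) _); apply/matrixP=> a j; rewrite !mxE.
- by rewrite rmorphXn /= rmorph_nat.
- by rewrite rmorphXn /= rmorph_nat.
- by rewrite rmorphD rmorphM /= !rmorph_nat.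
Qed.

Lemma card_supp_shifted_pairs (x : 'rV_k.+1) (p := rVpoly x) :
  (#|supp (x *m B)| + (#|roots0 p| + #|roots1 p|) =
   k + k + ((psi 1 p != 0)%R + (psi k.-1 p != 0)%R))%N.
Proof.
have horn (z : F) : \sum_(a < k.+1) x 0 a * z ^+ a = p.[z].
  rewrite (horner_coef_wide _ (size_poly _ _)); apply: eq_bigr => a _.
  by rewrite coef_rVpoly_ord.
have coefE m : (m < k.+1)%N -> \sum_(a < k.+1) x 0 a * (a == m :> nat)%:R = p`_m.
  move=> mk; rewrite (bigD1 (Ordinal mk)) //= eqxx mulr1 big1 ?addr0 => [|a].
    by rewrite -coef_rVpoly_ord.
  by rewrite -val_eqE /= => /negPf ->; rewrite mulr0.
have psiE d : \sum_(a < k.+1) x 0 a * ((a == k.-1 :> nat)%:R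
    + (W + d)%:R * (a == k :> nat)%:R) = psi d p.
  rewrite /psi -!coefE ?ltnS ?leq_pred // big_distrr -big_split /=.
  by apply: eq_bigr => a _; rewrite mulrDr [in RHS]mulrCA.
have suppE (z : 'I_k -> F) :
    (#|supp (x *m \matrix_(a, j) z j ^+ a)| + #|[set j | root p (z j)]| = k)%N.
  rewrite addnC -[RHS]card_ord -(cardC [set j | root p (z j)]); congr addn.
  apply: eq_card => j; rewrite !inE mxE /root -horn.
  by congr (_ != _); apply: eq_bigr => a _; rewrite mxE.
rewrite !mul_mx_row !card_supp_row_mx addnAC addnACA !suppE; congr addn.
rewrite card_supp !big_ord_recl big_ord0 addn0 ![(x *m _) _ _]mxE.
under eq_bigr do rewrite mxE.
under [in X in (_ + X)%N]eq_bigr do rewrite mxE.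
by rewrite !psiE.
Qed.

(** The sets of size d = 1 and d = k - 1: their pair polynomials are the 2k minimal words. *)
Let T (i : 'I_k + 'I_k) : {set 'I_k} :=
  match i with inl a => [set a] | inr a => [set~ a] end.
Let rho i : 'rV[F]_k.+1 := poly_rV (pair_poly (T i)).

Let rhoK i : rVpoly (rho i) = pair_poly (T i).
Proof. by rewrite poly_rV_K // size_pair_poly. Qed.

Let card_setC1 (a : 'I_k) : #|[set~ a]| = k.-1.
Proof. by rewrite cardsC1 card_ord. Qed.

Lemma pair_poly1 a :
  pair_poly [set a] = \prod_j ('X - (z0 j)%:P) - ell z0 a.
Proof.
rewrite -(mul_ell z0 a) /pair_poly (bigD1 a) //= {1}/zz set11.
rewrite (eq_bigr (fun j => 'X - (z0 j)%:P)) => [|j ja]; last first.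
  by rewrite /zz in_set1 (negPf ja).
by rewrite -/(ell z0 a) z1E polyCD polyC1; ring.
Qed.

Lemma pair_polyC1 a :
  pair_poly [set~ a] = \prod_j ('X - (z1 j)%:P) + ell z1 a.
Proof.
rewrite -(mul_ell z1 a) /pair_poly (bigD1 a) //= {1}/zz !inE eqxx /=.
rewrite (eq_bigr (fun j => 'X - (z1 j)%:P)) => [|j ja]; last first.
  by rewrite /zz !inE ja.
by rewrite -/(ell z1 a) z1E polyCD polyC1; ring.
Qed.

(* The functionals psi separate the two halves of a relation: both halves
   have coefficient sum 0. What remains is an equality between two Lagrange
   interpolants of degree at most k - 2, and it has too many roots. *)
Lemma shifted_pairs_indep (c : 'I_k + 'I_k -> F) :
  (#|[set i | c i != 0%R]| <= k.+1)%N ->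
  \sum_i c i *: rho i = 0 -> forall i, c i = 0.
Proof.
pose c0 a := c (inl a); pose c1 a := c (inr a) => cc E.
have {}E : \sum_a c0 a *: pair_poly [set a] + \sum_a c1 a *: pair_poly [set~ a] = 0.
  have := congr1 rVpoly E; rewrite linear_sum linear0 /= big_sumType /= => E'; rewrite -[RHS]E'.
  by congr (_ + _); apply: eq_bigr => a _; rewrite linearZ /= rhoK.
have coefE m : \sum_a c0 a * (pair_poly [set a])`_m
    + \sum_a c1 a * (pair_poly [set~ a])`_m = 0.
  have := congr1 (fun p : {poly F} => p`_m) E; rewrite coefD !coef_sum coef0 => E'; rewrite -[RHS]E'.
  by congr (_ + _); apply: eq_bigr => a _; rewrite coefZ.
have sum1 : \sum_a c0 a + \sum_a c1 a = 0.
  rewrite -[RHS](coefE k).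
  by congr (_ + _); apply: eq_bigr => a _; rewrite coef_pair_poly mulr1.
have sum2 : (\sum_a c0 a) * (W + 1)%:R + (\sum_a c1 a) * (W + k.-1)%:R = 0.
  apply/eqP; rewrite -oppr_eq0 opprD -!mulrN; apply/eqP.
  rewrite -[RHS](coefE k.-1) !big_distrl /=.
  congr (_ + _); apply: eq_bigr => a _; rewrite coefP_pair_poly //.
    by rewrite cards1.
  by rewrite card_setC1.
have c1sum : \sum_a c1 a = 0.
  move/eqP: sum1; rewrite addr_eq0 => /eqP E0; move/eqP: sum2.
  rewrite E0 mulNr addrC -mulrBr mulf_eq0 subr_eq0 eqr_nat eqn_add2l (negPf k1_neq1).
  by rewrite orbF => /eqP.
have c0sum : \sum_a c0 a = 0 by rewrite -[RHS]sum1 c1sum addr0.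
pose g := \sum_a c0 a *: ell z0 a.
have gE : g = \sum_a c1 a *: ell z1 a.
  apply/eqP; rewrite eq_sym -subr_eq0; apply/eqP; rewrite -[RHS]E.
  under [in RHS]eq_bigr do rewrite pair_poly1 scalerBr.
  under [in X in _ = _ + X]eq_bigr do rewrite pair_polyC1 scalerDr.
  rewrite sumrB big_split /= -!scaler_suml c0sum c1sum !scale0r.
  by rewrite sub0r add0r addrC.
(* Each zero coefficient of the relation is a root of g at its own node. At least 2k - (k + 1) = k -
   1 coefficients vanish, while g has degree at most k - 2. *)
have g0 : g = 0.
  apply/eqP; apply: contraT => /card_roots.
  have -> : roots0 g = [set a | c0 a == 0].
    by apply/setP=> a; rewrite !inE /root (horner_sum_ell z0_inj).
  have -> : roots1 g = [set a | c1 a == 0].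
    by apply/setP=> a; rewrite !inE gE /root (horner_sum_ell z1_inj).
  have sg : (size g <= k.-1)%N by apply: size_sum_ell.
  have cC (d : 'I_k -> F) : (#|[set a | d a == 0%R]| + #|[set a | d a != 0%R]| = k)%N.
    rewrite -[RHS]card_ord -(cardC [set a | d a == 0]); congr addn.
    by apply: eq_card => a; rewrite !inE.
  have := cC c0; have := cC c1; move: cc.
  have -> : #|[set i | c i != 0%R]| = (#|[set a | c0 a != 0%R]| + #|[set a | c1 a != 0%R]|)%N.
    rewrite -!sum1_card big_mkcond big_sumType /= -!big_mkcond /=.
    by congr addn; apply: eq_bigl => a; rewrite !inE.
  move: sg k_gt0; lia.
case=> a; apply/eqP.
  by rewrite -[c _]/(c0 a) -(horner_sum_ell z0_inj) -/g g0 horner0.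
by rewrite -[c _]/(c1 a) -(horner_sum_ell z1_inj) -gE g0 horner0.
Qed.

(** There are at most k roots among the nodes. If no [psi] vanishes, the weight is at least k + 2;
    if exactly one does, it is at least k + 1, with equality for k roots. If both vanish, p has
    degree at most k - 2, so at most k - 2 roots, and the weight is again at least k + 2. *)
Lemma weight_dichotomy (p : {poly F}) m : p != 0 -> (size p <= k.+1)%N ->
  (m + (#|roots0 p| + #|roots1 p|) =
   k + k + ((psi 1 p != 0)%R + (psi k.-1 p != 0)%R))%N ->
  (k.+1 < m)%N \/ [/\ m = k.+1, (#|roots0 p| + #|roots1 p| = k)%N &
                      psi 1 p = 0 \/ psi k.-1 p = 0].
Proof.
move=> p0 sp; have rp := card_roots p0; set n := (_ + _)%N in rp *.
have nk : (n <= k)%N by rewrite -ltnS; apply: leq_trans rp sp.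
have one_zero : (m + n = k + k + 1)%N -> psi 1 p = 0 \/ psi k.-1 p = 0 ->
    (k.+1 < m)%N \/ [/\ m = k.+1, n = k & psi 1 p = 0 \/ psi k.-1 p = 0].
  move=> mE psi0; have [mk|mk] := ltnP k.+1 m; [by left|right].
  have nE : n = k.
    apply/eqP; rewrite eqn_leq nk -(leq_add2l k.+1) addSn -addn1 -mE.
    by rewrite leq_add2r.
  by split=> //; move: mE; rewrite nE addnAC => /addIn ->; rewrite addn1.
have [p1|p1] := eqVneq (psi 1 p) 0; have [p2|p2] := eqVneq (psi k.-1 p) 0 => /= mE.
- left; have [pk pk1] := psi_eq0 p1 p2.
  rewrite -(ltn_add2r n) mE !addn0 addSnnS ltn_add2l -ltn_predRL.
  apply: leq_trans rp _; apply/leq_sizeP => j kj; have [->//|jk] := eqVneq j k.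
  have [->//|jk1] := eqVneq j k.-1.
  have : (k.-1 < j)%N by rewrite ltn_neqAle eq_sym jk1.
  rewrite prednK // => kj'; rewrite nth_default //; apply: leq_trans sp _.
  by rewrite ltn_neqAle eq_sym jk.
- exact: one_zero mE (or_introl p1).
- by apply: one_zero (or_intror p2); rewrite mE.
- by left; rewrite -(ltn_add2r n) mE addn2 addSn !ltnS leq_add2l.
Qed.

Lemma shifted_pairs_code : dense_code B rho.
Proof.
have T_card i : #|T i| = if i is inl _ then 1%N else k.-1.
  by case: i => a /=; rewrite ?cards1 ?card_setC1.
have dichotomy (x : 'rV[F]_k.+1) (x0 : x != 0) : rVpoly x != 0 /\
    ((k.+1 < #|supp (x *m B)|)%N \/
    [/\ #|supp (x *m B)| = k.+1,
        (#|roots0 (rVpoly x)| + #|roots1 (rVpoly x)| = k)%N &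
        psi 1 (rVpoly x) = 0 \/ psi k.-1 (rVpoly x) = 0]).
  have p0 : rVpoly x != 0.
    by apply: contra_neq x0 => /(congr1 (@poly_rV F k.+1)); rewrite rVpolyK linear0.
  split=> //; apply: weight_dichotomy (card_supp_shifted_pairs x) => //.
  exact: size_poly.
split; last exact: shifted_pairs_indep.
- by rewrite card_sum !card_ord.
- by move=> x /dichotomy [_ [/ltnW //|[-> _ _]]].
- move=> i; have r0 : rho i != 0.
    apply/eqP => /(congr1 rVpoly); rewrite rhoK linear0 => /eqP.
    by rewrite (negPf (monic_neq0 (pair_poly_monic _))).
  have : (_ + _ = _)%N := card_supp_shifted_pairs (rho i).
  rewrite rhoK; have [-> ->] := roots_pair_poly (T i); rewrite !psi_pair_poly.
  have -> : (#|~: T i| + #|T i| = k)%N by rewrite addnC cardsC card_ord.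
  have -> : ((#|T i| != 1) + (#|T i| != k.-1) = 1)%N.
    by rewrite T_card; case: i {r0} => a; rewrite eqxx ?(negPf k1_neq1) // eq_sym (negPf k1_neq1).
  by rewrite (addnAC k k 1) => /addIn ->; rewrite addn1.
move=> x cx; have x0 : x != 0.
  by apply: contra_eq_neq cx => ->; rewrite mul0mx supp0 cards0.
have [p0 [|[_ cr psi0]]] := dichotomy x x0; first by rewrite cx ltnn.
have found d : psi d (rVpoly x) = 0 -> (d <= k)%N ->
    (forall U : {set 'I_k}, #|U| = d -> exists i, U = T i) ->
    exists i c, x = c *: rho i.
  move=> pd dk hU; have [U /hU [j ->] E] := pair_polyP p0 (size_poly _ _) cr dk pd.
  exists j, (rVpoly x)`_k; apply: (can_inj (@rVpolyK F k.+1)).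
  by rewrite linearZ /= rhoK.
case: psi0 => /found; apply; rewrite ?leq_pred // => U cU.
  by have /eqP/cards1P [a ->] := cU; exists (inl a).
have /eqP/cards1P [a Ua] : #|~: U| = 1%N.
  have := cardsC U; rewrite card_ord cU -[RHS](prednK k_gt0) -addn1.
  exact: addnI.
by exists (inr a); rewrite /= -Ua setCK.
Qed.

End ShiftedPairs.

(** * The code for k = 2 *)

Section CompleteGraph.
Variable F : numFieldType.

(* The cut space of the complete graph K_4 with vertices 0, 1, 2 and a root:
   x gives the potentials of 0, 1, 2, and the root has potential 0. *)
Definition cut_mx : 'M[F]_(3, 3 + 3) :=
  row_mx 1%:M (\matrix_(a, j) ((a == j)%:R - (a == j + 1)%:R)).

(** [None] is the root: potential 1 at the three other vertices cuts exactly the edges at the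
    root. *)
Definition vertex_cut (i : option 'I_3) : 'rV[F]_3 :=
  if i is Some a then delta_mx 0 a else const_mx 1.

Lemma cut_mx_conj (conj : {rmorphism F -> F}) : map_mx conj cut_mx = cut_mx.
Proof.
rewrite map_row_mx map_mx1; congr row_mx; apply/matrixP=> a j.
by rewrite !mxE rmorphB /= !rmorph_nat.
Qed.

Let vec (u v t : F) : 'rV[F]_3 := \row_j nth 0 [:: u; v; t] j.

Let vecP x : exists u v t, x = vec u v t.
Proof.
exists (x 0 0), (x 0 1), (x 0 (1 + 1)); apply/rowP => j; rewrite mxE.
by case: j => -[|[|[|//]]] jlt /=; congr (x _ _); apply: val_inj.
Qed.

Lemma card_supp_cut u v t : #|supp (vec u v t *m cut_mx)| =
  ((u != 0)%R + (v != 0)%R + (t != 0)%R + (u != v)%R + (v != t)%R + (t != u)%R)%N.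
Proof.
(* The sum j + 1 is modulo 3, so the last three columns are the edges of the triangle 0, 1, 2, and
   the first three the edges to the root. *)
have cutE (x : 'rV[F]_3) :
    x *m cut_mx = row_mx x (\row_j (x 0 j - x 0 (j + 1))).
  rewrite mul_mx_row mulmx1; congr row_mx; apply/rowP => j; rewrite !mxE.
  under eq_bigr do rewrite mxE mulrBr.
  rewrite sumrB (bigD1 j) //= eqxx mulr1 big1 ?addr0; last first.
    by move=> a /negPf ->; rewrite mulr0.
  rewrite (bigD1 (j + 1)) //= eqxx mulr1 big1 ?addr0 //.
  by move=> a /negPf ->; rewrite mulr0.
rewrite cutE card_supp_row_mx !card_supp !big_ord_recl !big_ord0 !mxE /=.
by rewrite !subr_eq0 !addnA !addn0.
Qed.

(** A potential partitions the four vertices by its values. Isolating one vertex cuts 3 edges, a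
    partition into two pairs cuts 4, and any finer one at least 5. *)
Lemma cut_code : dense_code cut_mx vertex_cut.
Proof.
have rhoE i : exists u v t, vertex_cut i = vec u v t /\
    #|supp (vec u v t *m cut_mx)| = 3.
  case: i => [[[|[|[|//]]] alt]|].
  - exists 1, 0, 0; rewrite card_supp_cut ?eqxx ?(eq_sym 0) ?oner_neq0.
    split=> //; apply/rowP => -[[|[|[|//]]] jlt]; by rewrite !mxE.
  - exists 0, 1, 0; rewrite card_supp_cut ?eqxx ?(eq_sym 0) ?oner_neq0.
    split=> //; apply/rowP => -[[|[|[|//]]] jlt]; by rewrite !mxE.
  - exists 0, 0, 1; rewrite card_supp_cut ?eqxx ?(eq_sym 0) ?oner_neq0.
    split=> //; apply/rowP => -[[|[|[|//]]] jlt]; by rewrite !mxE.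
  - exists 1, 1, 1; rewrite card_supp_cut ?eqxx ?oner_neq0.
    split=> //; apply/rowP => -[[|[|[|//]]] jlt]; by rewrite !mxE.
have weights x : x != 0 -> (3 < #|supp (x *m cut_mx)|)%N \/
    #|supp (x *m cut_mx)| = 3 /\ exists i c, x = c *: vertex_cut i.
  have [u [v [t ->]]] := vecP x; rewrite card_supp_cut.
  have [->|u0] := eqVneq u 0; have [->|v0] := eqVneq v 0; have [->|t0] := eqVneq t 0;
    rewrite ?(eq_sym 0 u) ?(eq_sym 0 v) ?(eq_sym 0 t) ?u0 ?v0 ?t0 ?eqxx => x0;
    try by left; case: eqP.
  - by case/eqP: x0; apply/rowP => -[[|[|[|//]]] jlt]; by rewrite !mxE.
  - right; split=> //; exists (Some (1 + 1)), t.
    by apply/rowP => -[[|[|[|//]]] jlt]; rewrite !mxE ?mulr0 ?mulr1.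
  - right; split=> //; exists (Some 1), v.
    by apply/rowP => -[[|[|[|//]]] jlt]; rewrite !mxE ?mulr0 ?mulr1.
  - right; split=> //; exists (Some 0), u.
    by apply/rowP => -[[|[|[|//]]] jlt]; rewrite !mxE ?mulr0 ?mulr1.
  - have [->|uv] := eqVneq u v; have [->|vt] := eqVneq v t; rewrite ?eqxx; try by left.
      right; split=> //; exists None, t.
      by apply/rowP => -[[|[|[|//]]] jlt]; rewrite !mxE ?mulr1.
split.
- by rewrite card_option card_ord.
- by move=> x /weights [/ltnW //|[-> _]].
- by move=> i; have [u [v [t [-> ->]]]] := rhoE i.
- move=> x cx; have x0 : x != 0.
    by apply: contra_eq_neq cx => ->; rewrite mul0mx supp0 cards0.
  by have [|[]//] := weights x x0; rewrite cx ltnn.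
(* All relations are multiples of one with four nonzero coefficients, so a single vanishing
   coefficient kills the others. *)
move=> c cc E; have cE a : c None + c (Some a) = 0.
  have /rowP/(_ a) := E; rewrite summxE mxE => <-.
  rewrite (bigD1 None) // (bigD1 (Some a)) //= big1 ?addr0 ?mxE ?eqxx ?mulr1 //.
  case=> [b|] //; rewrite !mxE /=; case: (eqVneq a b) => [->|_ _]; rewrite ?eqxx //.
  by rewrite mulr0.
have /existsP [i /eqP ci] : [exists i, c i == 0].
  move: cc; apply: contraLR; rewrite negb_exists -ltnNge => /forallP h.
  rewrite (_ : [set i | _] = setT) ?cardsT ?card_option ?card_ord //.
  by apply/setP=> i; rewrite !inE h.
have cN : c None = 0 by case: i ci => // a ca; rewrite -[RHS](cE a) ca addr0.
by case=> // b; rewrite -[RHS](cE b) cN add0r.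
Qed.

End CompleteGraph.

Theorem theorem4p13 (R : realType) (k : nat) (hk : (2 <= k)%N) :
  (exists N : nat, forall n : nat, (N <= n)%N ->
     exists_dense_arrangement (F := R) idfun k n) /\
  (exists N : nat, forall n : nat, (N <= n)%N ->
     exists_dense_arrangement (F := R[i]%C) (@conjc R) k n).
Proof.
suff dense (F : numFieldType) (conj : {rmorphism F -> F}) :
    (forall x, conj x = x -> x \is Num.real) ->
    exists N : nat, forall n : nat, (N <= n)%N -> exists_dense_arrangement conj k n.
  split; first by apply: dense => x _; apply: num_real.
  apply: dense => -[a b] /= [] /eqP; rewrite eqNr => /eqP ->.
  by rewrite complex_real.
move=> conj_real; have [k2|k_gt2] := eqVneq k 2%N.
  (* N is the length of the code; the other n - N hyperplanes come from zero columns. *)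
  exists (3 + 3)%N => n /subnKC <-; rewrite k2.
  exact: (dense_code_arrangement (k := 2) _ conj_real _ (cut_mx_conj conj) (cut_code F)).
exists (k + k + 2)%N => n /subnKC <-.
have k3 : (2 < k)%N by rewrite ltn_neqAle eq_sym k_gt2.
exact: (dense_code_arrangement _ conj_real hk (shifted_pairs_mx_conj k conj)
  (shifted_pairs_code F k3)).
Qed.
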